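(* Let $A$ and $B$ be finite point sets in $\mathbb{R}^2$ with $|A|=n\ge m=|B|$. Then the combinatorial complexity (total number of vertices, edges and regions) of the partial-matching subdivision $\mathcal{D}_{B,A}$ is $O\big(n^2m^{3.5}(e\ln m+e)^m\big)$.
   Context: Write $B=\{b_1,\ldots,b_m\}$, $A=\{a_1,\ldots,a_n\}$. A matching is an injective map $\pi:B\to A$; its cost at translation $t\in\mathbb{R}^2$ is $f(\pi,t)=\sum_{i=1}^m\|b_i+t-a_{\pi(i)}\|^2=c_\pi+\langle t,d_\pi\rangle+m\|t\|^2$ with $c_\pi=\sum_i\|b_i-a_{\pi(i)}\|^2$, $d_\pi=2\sum_i(b_i-a_{\pi(i)})$. The partial-matching subdivision $\mathcal{D}_{B,A}$ is the subdivision of the plane of translations in which $t_1,t_2$ lie in the same region iff the set of injections minimizing $f(\cdot,t)$ is the same at $t_1$ and $t_2$; equivalently, the minimization diagram of the lower envelope $\min_\pi(c_\pi+\langle t,d_\pi\rangle)$. It is a convex polygonal subdivision of the plane. *)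

(* Defs.v *)
From HB Require Import structures.
From mathcomp Require Import all_boot all_order all_algebra.
From mathcomp Require Import boolp reals sequences exp.
Set Implicit Arguments. Unset Strict Implicit. Unset Printing Implicit Defensive.
Import Order.TTheory GRing.Theory Num.Theory.
Local Open Scope ring_scope.

Section PM.
Variable R : realType.

Definition sqnorm (p : R * R) : R := p.1 ^+ 2 + p.2 ^+ 2.

Definition match_cost (n m : nat) (a : 'I_n -> R * R) (b : 'I_m -> R * R)
  (pi : {ffun 'I_m -> 'I_n}) (t : R * R) : R :=
  \sum_(i < m) sqnorm ((b i).1 + t.1 - (a (pi i)).1,
                       (b i).2 + t.2 - (a (pi i)).2).

Definition opt_matchings (n m : nat) (a : 'I_n -> R * R) (b : 'I_m -> R * R)
  (t : R * R) : {set {ffun 'I_m -> 'I_n}} :=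
  [set pi : {ffun 'I_m -> 'I_n} | injectiveb pi &&
     [forall sigma : {ffun 'I_m -> 'I_n},
        injectiveb sigma ==> (match_cost a b pi t <= match_cost a b sigma t)]].

(* Combinatorial complexity of D_{B,A}: the number of cells (vertices, edges,
   regions) = number of distinct minimizer sets realized by some translation t
   (each such class is a relatively open convex face of the diagram). *)
Definition pm_complexity (n m : nat) (a : 'I_n -> R * R) (b : 'I_m -> R * R)
  : nat :=
  #|[set S : {set {ffun 'I_m -> 'I_n}} | `[< exists t : R * R, S = opt_matchings a b t >] ]|.

End PM.

(* Main.v *)
Require Import Defs.
From HB Require Import structures.
From mathcomp Require Import all_boot all_order all_algebra.
From mathcomp Require Import boolp reals sequences exp.
From mathcomp Require Import ring lra zify.
Import Order.TTheory GRing.Theory Num.Theory.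
Set Implicit Arguments. Unset Strict Implicit. Unset Printing Implicit Defensive.
Local Open Scope ring_scope.

(* A cell of D_{B,A} that is a region or an edge is determined by two nearby
   generic regions, and a vertex by one nearby generic region of which it is the
   extreme point, together with a sign. A region is given by the image of an
   optimal matching, the cost depending on the image only through [d_pi].

   Call the type of a generic translation [t] the data, for every agent [b_k] and
   every set [D] of fewer than [m] houses of [A], of the house nearest to
   [b_k + t] outside [D]. A type leaves at most [4 ^ m] possible images: an optimal
   matching never leaves unused a house that some agent prefers to its own, so the
   image can be read off from at most [2 m] yes/no answers. Since any [c ^ m] is
   [O((e ln m + e) ^ m)], it remains to see that there are [O(n ^ 2 c ^ m)] types.

   The translations of a given type form a convex set cut out by halfplanes, one
   for each comparison of a nearest house [p] with another house [q] outside [D].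
   By Helly's theorem in the plane, two of these halfplanes already determine the
   infimum of the norm on it. A random subset of [A] avoids [D] and contains [p]
   and [q] with probability at least [2 ^ -(m + 1)]; once two such samples are
   fixed, the two halfplanes may be replaced by the Voronoi cells of the houses
   [p] in the samples, so the type is determined by two agents and two houses. *)

(** * Helly's theorem in the plane *)

(* Four points suffice for Radon's theorem in the plane, hence the index ['I_4]. *)
Definition convex4 {R : realType} (A : R * R -> Prop) : Prop :=
  forall (w : 'I_4 -> R) (P : 'I_4 -> R * R),
    (forall i, 0 <= w i) -> \sum_i w i = 1 ->
    (forall i, w i != 0 -> A (P i)) ->
    A (\sum_i w i * (P i).1, \sum_i w i * (P i).2).

(** Four vectors [(1, x, y)] of a three-dimensional space are linearly dependent. *)
Lemma radon_dependence (R : realType) (P : 'I_4 -> R * R) :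
  exists l : 'I_4 -> R, [/\ exists i, l i != 0, \sum_i l i = 0,
    \sum_i l i * (P i).1 = 0 & \sum_i l i * (P i).2 = 0].
Proof.
pose M : 'M[R]_(4, 3) :=
  \matrix_(i < 4, j < 3) [:: 1; (P i).1; (P i).2]`_j.
have kM : kermx M != 0.
  rewrite kermx_eq0 /row_free neq_ltn; apply/orP; left.
  by rewrite (leq_ltn_trans (rank_leq_col M)).
set v := nz_row (kermx M).
have vM : v *m M = 0 by apply/sub_kermxP; exact: nz_row_sub.
have v0 : v != 0 by rewrite nz_row_eq0.
have vMj (j : 'I_3) : \sum_i v 0 i * M i j = 0.
  by have := congr1 (fun A : 'rV[R]_3 => A 0 j) vM; rewrite !mxE.
exists (fun i => v 0 i); split.
- apply: contrapT => h; move/eqP: v0; apply; apply/rowP => i; rewrite mxE.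
  by apply/eqP/negPn/negP => vi; apply: h; exists i.
- rewrite -[RHS](vMj 0); apply: eq_bigr => i _; rewrite mxE /=; ring.
- by rewrite -[RHS](vMj 1); apply: eq_bigr => i _; rewrite mxE.
- by rewrite -[RHS](vMj 2%:R); apply: eq_bigr => i _; rewrite mxE.
Qed.

(** Splitting an affine dependence into its positive part [p] and negative part [q] writes Radon's
    point [x] as a convex combination in two ways. For each [j] one of them gives [P j] weight zero
    and so uses only points of [A j]. *)
Lemma helly4 (R : realType) (A : 'I_4 -> R * R -> Prop) (P : 'I_4 -> R * R) :
  (forall i, convex4 (A i)) -> (forall i j, i != j -> A j (P i)) ->
  exists x, forall j, A j x.
Proof.
move=> cA AP; have [l [[i0 li0] l0 l1 l2]] := radon_dependence P.
pose p i := Num.max (l i) 0; pose q i := Num.max (- l i) 0.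
have lpq i : l i = p i - q i.
  rewrite /p /q; case: (leP (l i) 0) => h; first by rewrite max_l; lra.
  by rewrite max_r; lra.
have p0 i : 0 <= p i by rewrite le_max lexx orbT.
have q0 i : 0 <= q i by rewrite le_max lexx orbT.
have eqpq (f : 'I_4 -> R) : \sum_i l i * f i = 0 ->
    \sum_i p i * f i = \sum_i q i * f i.
  move=> h; apply/eqP; rewrite -subr_eq0 -sumrB -[X in _ == X]h; apply/eqP.
  by apply: eq_bigr => i _; rewrite lpq mulrBl.
pose s := \sum_i p i.
have sq : s = \sum_i q i.
  have := eqpq (fun=> 1); rewrite /s.
  under eq_bigr do rewrite mulr1.
  move=> /(_ l0).
  by under eq_bigr do rewrite mulr1; under [RHS]eq_bigr do rewrite mulr1.
have s0 : 0 < s.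
  rewrite lt_def sumr_ge0 // andbT; apply/eqP => /eqP sE.
  have pz : p i0 = 0.
    by move: sE; rewrite /s psumr_eq0 // => /allP/(_ i0 (mem_index_enum _))/eqP.
  have qz : q i0 = 0.
    move/eqP: sE; rewrite sq => /eqP; rewrite psumr_eq0 //.
    by move=> /allP/(_ i0 (mem_index_enum _))/eqP.
  by move: li0; rewrite lpq pz qz subrr eqxx.
pose x := (\sum_i (p i / s) * (P i).1, \sum_i (p i / s) * (P i).2).
have comb (r : 'I_4 -> R) (j : 'I_4) : (forall i, 0 <= r i) -> \sum_i r i = s ->
    r j = 0 -> A j (\sum_i (r i / s) * (P i).1, \sum_i (r i / s) * (P i).2).
  move=> r0 rs rj; apply: (cA j).
  - by move=> i; rewrite divr_ge0 // ltW.
  - by rewrite -mulr_suml rs divff // gt_eqF.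
  - move=> i ri; apply: AP; apply: contraNneq ri => ->.
    by rewrite rj mul0r.
exists x => j; case: (leP (l j) 0) => lj.
  by apply: comb => //; rewrite /p max_r.
have -> : x = (\sum_i (q i / s) * (P i).1, \sum_i (q i / s) * (P i).2).
  rewrite /x; congr pair.
    under eq_bigr do rewrite mulrAC; rewrite -mulr_suml (eqpq _ l1) mulr_suml.
    by apply: eq_bigr => i _; rewrite mulrAC.
  under eq_bigr do rewrite mulrAC; rewrite -mulr_suml (eqpq _ l2) mulr_suml.
  by apply: eq_bigr => i _; rewrite mulrAC.
by apply: comb => //; rewrite /q max_r // oppr_le0 ltW.
Qed.

Lemma convex4I (R : realType) (A B : R * R -> Prop) :
  convex4 A -> convex4 B -> convex4 (fun x => A x /\ B x).
Proof.
move=> cA cB w P w0 w1 h; split; [apply: cA | apply: cB] => // i wi.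
- by case: (h i wi).
- by case: (h i wi).
Qed.

Lemma helly4_sets (R : realType) (A B C D : R * R -> Prop) :
  convex4 A -> convex4 B -> convex4 C -> convex4 D ->
  (exists x, [/\ A x, B x & C x]) -> (exists x, [/\ A x, B x & D x]) ->
  (exists x, [/\ A x, C x & D x]) -> (exists x, [/\ B x, C x & D x]) ->
  exists x, [/\ A x, B x, C x & D x].
Proof.
move=> cA cB cC cD [d [? ? ?]] [c [? ? ?]] [b [? ? ?]] [a [? ? ?]].
pose F (i : 'I_4) := nth A [:: A; B; C; D] i.
have [||x Fx] := @helly4 R F (fun i => nth a [:: a; b; c; d] i).
- by case=> [] [|[|[|[|i]]]] //= ?.
- by case=> [] [|[|[|[|i]]]] //= ? [] [|[|[|[|j]]]].
by exists x; split; [exact: (Fx 0)|exact: (Fx 1)|exact: (Fx 2%:R)|exact: (Fx 3%:R)].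
Qed.

(** Induction on the number of sets, merging the last one into the first; [helly4_sets] restores the
    hypothesis for triples containing the merged set. *)
Lemma helly (R : realType) (N : nat) (F : nat -> R * R -> Prop) :
  (forall i, convex4 (F i)) ->
  (forall i j k, (i < N)%N -> (j < N)%N -> (k < N)%N ->
     exists x, [/\ F i x, F j x & F k x]) ->
  exists x, forall i, (i < N)%N -> F i x.
Proof.
elim: N F => [|[|N] IH] F cF h; first by exists (0, 0).
  have [//|//|//|x [Fx _ _]] := h 0%N 0%N 0%N.
  by exists x => -[|i].
pose G i x := if i == 0%N then F 0%N x /\ F N.+1 x else F i x.
have h4 i j : (i < N.+1)%N -> (j < N.+1)%N ->
    exists x, [/\ F 0%N x, F N.+1 x, F i x & F j x].
  by move=> iN jN; apply: helly4_sets => //; apply: h => //; apply: ltnW.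
have [||x Gx] := IH G.
- by move=> i; rewrite /G; case: eqP => // _; apply: convex4I.
- move=> i j k iN jN kN; rewrite /G.
  case: (eqVneq i 0%N) => [i0|_].
    have [x [? ? ? ?]] := h4 j k jN kN.
    by exists x; split=> //; case: ifP.
  case: (eqVneq j 0%N) => [j0|_].
    have [x [? ? ? ?]] := h4 i k iN kN.
    by exists x; split=> //; case: ifP.
  case: (eqVneq k 0%N) => [k0|_].
    by have [x [? ? ? ?]] := h4 i j iN jN; exists x.
  by apply: h; apply: ltnW.
exists x => i; rewrite ltnS leq_eqVlt => /predU1P[->|iN].
  by have := Gx 0%N isT; rewrite /G /= => -[].
by have := Gx i iN; rewrite /G; case: eqP => [->|//] [].
Qed.

(** Triples without [L] share the point [x0], so only pairs together with [L] remain to be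
    tested. *)
Lemma helly_relative (R : realType) (I : finType) (i0 : I)
    (F : I -> R * R -> Prop) (L : R * R -> Prop) :
  convex4 L -> (forall i, convex4 (F i)) -> (exists x, forall i, F i x) ->
  (forall i j, exists x, [/\ L x, F i x & F j x]) ->
  exists x, L x /\ forall i, F i x.
Proof.
move=> cL cF [x0 Fx0] h.
pose G k := if k is k'.+1 then F (nth i0 (enum I) k') else L.
have [||x Gx] := @helly R #|I|.+1 G.
- by move=> [|i]; [exact: cL|exact: cF].
- case=> [|i] [|j] [|k] _ _ _ /=.
  + by have [x [? ? ?]] := h i0 i0; exists x.
  + by have [x [? ? ?]] := h (nth i0 (enum I) k) i0; exists x.
  + by have [x [? ? ?]] := h (nth i0 (enum I) j) i0; exists x.
  + by have [x [? ? ?]] := h (nth i0 (enum I) j) (nth i0 (enum I) k); exists x.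
  + by have [x [? ? ?]] := h (nth i0 (enum I) i) i0; exists x.
  + by have [x [? ? ?]] := h (nth i0 (enum I) i) (nth i0 (enum I) k); exists x.
  + by have [x [? ? ?]] := h (nth i0 (enum I) i) (nth i0 (enum I) j); exists x.
  + by exists x0.
exists x; split=> [|i]; first exact: (Gx 0%N).
by have := Gx (index i (enum I)).+1; rewrite /= nth_index ?mem_enum //; apply; rewrite ltnS cardE index_mem mem_enum.
Qed.
(** * Images of matchings compatible with given preferences *)

Definition stable_matching (n m : nat) (top : 'I_m -> {set 'I_n} -> 'I_n)
    (pi : {ffun 'I_m -> 'I_n}) (S : {set 'I_n}) : Prop :=
  [/\ injective pi, S = [set pi i | i : 'I_m] &
    forall i (D : {set 'I_n}), (#|D| < m)%N -> top i D \notin S -> pi i \in D].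

(** [D] collects houses known to be used, and [Q] the agents whose house may still lie outside [D].
    Probing [i] in [Q] either enlarges [D] by a used house or removes [i] from [Q], so the measure
    drops. Once [D] has [m] houses or [Q] is empty, the image is [D]. *)
Lemma card_stable_images_rec (n m : nat) (top : 'I_m -> {set 'I_n} -> 'I_n) :
  (forall i (D : {set 'I_n}), (#|D| < m)%N -> top i D \notin D) ->
  forall N (D : {set 'I_n}) (Q : {set 'I_m}), (m - #|D| + #|Q| <= N)%N ->
  (#|[set S : {set 'I_n} | `[< exists pi, [/\ stable_matching top pi S,
       D \subset S & forall i, i \notin Q -> pi i \in D] >]]| <= 2 ^ N)%N.
Proof.
move=> topD.
have cardS pi S : stable_matching top pi S -> #|S| = m.
  by move=> [pi_inj -> _]; rewrite card_imset // card_ord.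
have small N (D : {set 'I_n}) (Q : {set 'I_m}) : (m <= #|D|)%N || (Q == set0) ->
    (#|[set S : {set 'I_n} | `[< exists pi, [/\ stable_matching top pi S,
       D \subset S & forall i, i \notin Q -> pi i \in D] >]]| <= 2 ^ N)%N.
  move=> h; apply: (@leq_trans 1); last by rewrite expn_gt0.
  rewrite -(cards1 D); apply: subset_leq_card; apply/subsetP => S.
  rewrite !inE => /asboolP[pi [st DS piD]]; apply/eqP/esym/eqP.
  rewrite eqEcard DS /= (cardS _ _ st); case/orP: h => [//|/eqP Q0].
  rewrite -(cardS _ _ st); case: st => _ -> _; apply: subset_leq_card.
  by apply/subsetP => _ /imsetP[i _ ->]; apply: piD; rewrite Q0 inE.
elim=> [|N IH] D Q; last first.
  have [/small//|/norP[]] := boolP ((m <= #|D|)%N || (Q == set0)).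
  rewrite -ltnNge => Dm /set0Pn[i iQ] DQ.
  set x := top i D; have xD : x \notin D by apply: topD.
  have h1 : (m - #|x |: D| + #|Q| <= N)%N.
    by rewrite cardsU1 xD; move: DQ Dm; move: #|D| #|Q| => d q; lia.
  have h2 : (m - #|D| + #|Q :\ i| <= N)%N.
    by move: DQ; rewrite (cardsD1 i Q) iQ; move: #|D| #|_| => d q; lia.
  rewrite expnS mul2n -addnn.
  apply: leq_trans (leq_add (IH _ _ h1) (IH _ _ h2)).
  apply: leq_trans (leq_card_setU _ _); apply: subset_leq_card.
  apply/subsetP => S; rewrite !inE => /asboolP[pi [st DS piD]].
  apply/orP; have [xS|xS] := boolP (x \in S); [left|right]; apply/asboolP; exists pi.
    split=> //; first by rewrite subUset sub1set xS.
    by move=> j /piD; rewrite inE orbC => ->.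
  split=> // j; rewrite !inE negb_and negbK => /predU1P[->|/piD//].
  by case: st => _ _; apply.
by rewrite leqn0 addn_eq0 subn_eq0 cards_eq0 => /andP[mD _]; apply: small; rewrite mD.
Qed.

(* Probe the agents one at a time, removing from the market each probed house
   that is used and discarding each agent whose probed house is unused: at most
   [m] answers of either kind occur, and they determine the set of used houses. *)
Lemma card_stable_images (n m : nat) (top : 'I_m -> {set 'I_n} -> 'I_n) :
  (forall i (D : {set 'I_n}), (#|D| < m)%N -> top i D \notin D) ->
  (#|[set S : {set 'I_n} | `[< exists pi, stable_matching top pi S >]]| <= 4 ^ m)%N.
Proof.
move=> topD; have := @card_stable_images_rec n m top topD (m + m)%N set0 setT.
rewrite cards0 subn0 cardsT card_ord addnn -mul2n expnM => /(_ (leqnn _)).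
apply: leq_trans; apply: subset_leq_card; apply/subsetP => S.
rewrite !inE => /asboolP[pi st]; apply/asboolP; exists pi.
by split=> //; [rewrite sub0set|move=> i; rewrite inE].
Qed.

(** Only membership of the elements of [D] and [E] is prescribed, so a uniformly random subset
    qualifies with probability [2 ^ -(#|D| + #|E|)]. *)
Lemma card_samples (T : finType) (D E : {set T}) : [disjoint D & E] ->
  (2 ^ #|T| <= 2 ^ (#|D| + #|E|) *
     #|[set A : {set T} | [disjoint A & D] && (E \subset A)]|)%N.
Proof.
move=> DE; pose U := ~: (D :|: E).
have cU : (#|D| + #|E| + #|U| = #|T|)%N.
  rewrite -(cardsC (D :|: E)) cardsU.
  by move: DE; rewrite -setI_eq0 => /eqP ->; rewrite cards0 subn0.
rewrite -cU expnD leq_mul2l -card_powerset; apply/orP; right.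
rewrite -(@card_in_imset _ _ (fun B => B :|: E)).
  apply: subset_leq_card; apply/subsetP => _ /imsetP[B BU ->].
  rewrite inE subsetUr andbT -setI_eq0 setIUl setU_eq0 !setI_eq0.
  rewrite (disjoint_sym E) DE andbT disjoints_subset.
  move: BU; rewrite inE => /subset_trans; apply.
  by apply/subsetP => z; rewrite !inE; case: (z \in D).
move=> B C; rewrite !inE => /subsetP BU /subsetP CU /setP BC.
apply/setP => z; have := BC z; rewrite !inE.
have [zE _|//] := boolP (z \in E); last by rewrite !orbF.
have nU : z \notin U by rewrite !inE zE orbT.
by rewrite (contraNF (BU z)) // (contraNF (CU z)).
Qed.
(** * Counting types *)

Definition hdist {R : realType} (b a x : R * R) : R :=
  sqnorm (b.1 + x.1 - a.1, b.2 + x.2 - a.2).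

(** The quadratic terms cancel: an agent's comparison of two houses is affine in the translation,
    whence the halfplanes. *)
Lemma hdistB (R : realType) (b p q x y : R * R) :
  (hdist b q x - hdist b p x) - (hdist b q y - hdist b p y) =
  2 * ((p.1 - q.1) * (x.1 - y.1) + (p.2 - q.2) * (x.2 - y.2)).
Proof. by rewrite /hdist /sqnorm /=; ring. Qed.

Lemma convex4_hdist (R : realType) (b p q : R * R) (d : R) :
  convex4 (fun x => hdist b p x + d <= hdist b q x).
Proof.
move=> w P w0 w1 h; set x := (_, _).
have key : \sum_i w i * (hdist b q (P i) - hdist b p (P i)) =
    hdist b q x - hdist b p x.
  apply/eqP; rewrite -subr_eq0; apply/eqP.
  transitivity (\sum_i w i * ((hdist b q (P i) - hdist b p (P i))
                            - (hdist b q x - hdist b p x))).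
    under [RHS]eq_bigr do rewrite mulrBr.
    by rewrite [RHS]sumrB -mulr_suml w1 mul1r.
  under eq_bigr => i _.
    rewrite hdistB.
    have -> : w i * (2 * ((p.1 - q.1) * ((P i).1 - x.1) + (p.2 - q.2) * ((P i).2 - x.2)))
      = 2 * (p.1 - q.1) * (w i * (P i).1 - w i * x.1)
      + 2 * (p.2 - q.2) * (w i * (P i).2 - w i * x.2) by ring.
    over.
  rewrite big_split /= -!mulr_sumr !sumrB -!mulr_suml w1 /x /=; ring.
suff : d <= hdist b q x - hdist b p x by lra.
rewrite -key -[d]mul1r -w1 mulr_suml; apply: ler_sum => i _.
have [->|wi] := eqVneq (w i) 0; first by rewrite !mul0r.
by rewrite ler_wpM2l //; have := h i wi; lra.
Qed.

Lemma convex4_ball (R : realType) (r : R) : convex4 (fun x => sqnorm x < r).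
Proof.
move=> w P w0 w1 h; set x := (_, _).
(* Variance identity: the mean of the squared norms exceeds the squared norm of the mean by the mean
   squared deviation. *)
have key : \sum_i w i * sqnorm (P i) =
    sqnorm x + \sum_i w i * (((P i).1 - x.1) ^+ 2 + ((P i).2 - x.2) ^+ 2).
  apply/eqP; rewrite -subr_eq -sumrB; apply/eqP.
  transitivity (\sum_i (2 * x.1 * (w i * (P i).1) + 2 * x.2 * (w i * (P i).2)
      - w i * sqnorm x)).
    by apply: eq_bigr => i _; rewrite /sqnorm; ring.
  by rewrite sumrB big_split /= -!mulr_sumr -mulr_suml w1 /sqnorm /x /=; ring.
have le1 : sqnorm x <= \sum_i w i * sqnorm (P i).
  rewrite key lerDl sumr_ge0 // => i _.
  by rewrite mulr_ge0 // addr_ge0 // sqr_ge0.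
apply: (le_lt_trans le1); rewrite -[r]mul1r -w1 mulr_suml.
have [i wi] : exists i, w i != 0.
  apply: contrapT => nw; move: w1; rewrite big1 => [/esym/eqP|i _].
    by rewrite oner_eq0.
  by apply/eqP/negPn/negP => wi; apply: nw; exists i.
rewrite (bigD1 i) //= [ltRHS](bigD1 i) //=; apply: ltr_leD.
  by rewrite ltr_pM2l ?(h i wi) // lt_def wi w0.
apply: ler_sum => j _; have [->|wj] := eqVneq (w j) 0; first by rewrite !mul0r.
by rewrite ler_wpM2l // ltW // h.
Qed.

Lemma convex4_imp (R : realType) (P : Prop) (A : R * R -> Prop) :
  convex4 A -> convex4 (fun x => P -> A x).
Proof. by move=> cA w Q w0 w1 h p; apply: cA => // i wi; apply: h. Qed.

Lemma sqnorm_ge0 (R : realType) (x : R * R) : 0 <= sqnorm x.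
Proof. by rewrite addr_ge0 // sqr_ge0. Qed.

(** Near-minimizers stand in for a minimizer, so no compactness argument is called for. *)
Lemma sqnorm_inf (R : realType) (A : R * R -> Prop) : (exists x, A x) ->
  exists r : R, [/\ forall x, A x -> r <= sqnorm x &
    forall e, 0 < e -> exists x, A x /\ sqnorm x < r + e].
Proof.
move=> [x0 Ax0]; pose E : classical_sets.set R := fun r => exists x, A x /\ r = sqnorm x.
have lbE : classical_sets.has_lbound E.
  by exists 0 => _ [x [_ ->]]; apply: sqnorm_ge0.
exists (inf E); split=> [x Ax|e e0]; first by apply: ge_inf => //; exists x.
have infE : classical_sets.has_inf E by split=> //; exists (sqnorm x0), x0.
by have [_ [x [Ax ->]] xe] := inf_adherent e0 infE; exists x.
Qed.

Lemma uniform_gap (R : realType) (I : finType) (f : I -> R) :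
  exists d, 0 < d /\ forall i, 0 < f i -> d <= f i.
Proof.
(* The value [1] serves when no [f i] is positive. *)
exists (\big[Num.min/1]_(i | 0 < f i) f i); split.
  by elim/big_ind: _ => // x y x0 y0; rewrite lt_min x0.
by move=> i fi; apply: bigmin_le_cond.
Qed.

Section Types.
Variables (R : realType) (n m : nat) (K : finType).
Variables (a : 'I_n -> R * R) (beta : K -> R * R) (p0 : 'I_n).

Definition trim (D : {set 'I_n}) : {set 'I_n} := if (#|D| < m)%N then D else set0.

(** Agents are indexed by an arbitrary finite type [K], since two shifted copies of each are taken
    later. The default [p0] is resorted to only when [D] contains every house. *)
Definition nearest (x : R * R) (k : K) (D : {set 'I_n}) : 'I_n :=
  odflt p0 [pick p | (p \notin D) && [forall q, (q \notin D) ==>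
    (hdist (beta k) (a p) x <= hdist (beta k) (a q) x)]].

(* [trim] makes only the values on sets of fewer than [m] houses matter. *)
Definition typ (x : R * R) : {ffun K * {set 'I_n} -> 'I_n} :=
  [ffun i => nearest x i.1 (trim i.2)].

Definition generic (x : R * R) : Prop := forall k p q, p != q ->
  hdist (beta k) (a p) x != hdist (beta k) (a q) x.

Definition types : {set {ffun K * {set 'I_n} -> 'I_n}} :=
  [set tau | `[< exists x, generic x /\ typ x = tau >]].

Lemma nearestP x k (D : {set 'I_n}) : (#|D| < n)%N ->
  nearest x k D \notin D /\ forall q, q \notin D ->
    hdist (beta k) (a (nearest x k D)) x <= hdist (beta k) (a q) x.
Proof.
move=> Dn; rewrite /nearest; case: pickP => [p /andP[pD /forallP h]|none].
  by split=> //= q qD; have := h q; rewrite qD.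
exfalso.
have [q qD] : exists q, q \notin D.
  apply: contrapT => h; move: Dn; rewrite ltnNge -[X in (X <= _)%N]card_ord.
  case/negP; rewrite -cardsT; apply: subset_leq_card; apply/subsetP => q _.
  by apply/negPn/negP => qD; apply: h; exists q.
pose p := [arg min_(p < q | p \notin D) hdist (beta k) (a p) x]%O.
have := none p; rewrite /p; case: arg_minP => // p' p'D h.
by rewrite p'D => /negP; apply; apply/forallP => q'; apply/implyP => /h.
Qed.

Hypothesis mn : (0 < m <= n)%N.

Lemma card_trim D : (#|trim D| < m)%N.
Proof. by rewrite /trim; case: ifP => // _; rewrite cards0; case/andP: mn. Qed.

Lemma typP x k D : typ x (k, D) \notin trim D /\ forall q, q \notin trim D ->
  hdist (beta k) (a (typ x (k, D))) x <= hdist (beta k) (a q) x.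
Proof.
rewrite ffunE; apply: nearestP; apply: leq_trans (card_trim D) _.
by case/andP: mn.
Qed.

End Types.

(** * Types determined by two slackened Voronoi cells *)

Section TypeCount.
Variables (R : realType) (n m : nat) (K : finType).
Variables (a : 'I_n -> R * R) (beta : K -> R * R) (p0 : 'I_n) (d : R).
Hypothesis mn : (0 < m <= n)%N.

Local Notation type := {ffun K * {set 'I_n} -> 'I_n}.
Local Notation trim := (@trim n m).
Local Notation types := (types m a beta p0).
Implicit Types (tau : type) (x : R * R) (k : K) (p q : 'I_n) (A D : {set 'I_n}).
Implicit Types i : K * {set 'I_n} * 'I_n.

(* The slack [d] keeps the sets of points of distinct types apart. *)
Definition constr tau i x : Prop := i.2 \notin trim i.1.2 -> i.2 != tau i.1 ->
  hdist (beta i.1.1) (a (tau i.1)) x + d <= hdist (beta i.1.1) (a i.2) x.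

(** The Voronoi cell of [p] among the houses of [A], as seen by agent [k] and shrunk by the slack
    [d]. *)
Definition cell k A p x : Prop := forall z, z \in A -> z != p ->
  hdist (beta k) (a p) x + d <= hdist (beta k) (a z) x.

(** When [i.2] lies in the set to be avoided, requiring it would leave no sample; the constraint [i]
    is void in that case. *)
Definition wanted tau i : {set 'I_n} :=
  tau i.1 |: (if i.2 \in trim i.1.2 then set0 else [set i.2]).

Definition samples tau i : {set {set 'I_n}} :=
  [set A : {set 'I_n} | [disjoint A & trim i.1.2] && (wanted tau i \subset A)].

Lemma convex4_constr tau i : convex4 (constr tau i).
Proof. by do 2! apply: convex4_imp; apply: convex4_hdist. Qed.

(** With [cell_constr] this sandwiches the cell between the set of all points of type [tau] with
    slack and the halfplane of [i], so putting cells for the two deciding halfplanes keeps the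
    infimum of the norm. *)
Lemma constr_cell tau i A x : A \in samples tau i ->
  (forall i', constr tau i' x) -> cell i.1.1 A (tau i.1) x.
Proof.
rewrite inE => /andP[/pred0P AD _] h z zA zp.
have zD : z \notin trim i.1.2 by have := AD z; rewrite /= zA => /negbT.
have := h (i.1, z); rewrite /constr /=; exact.
Qed.

Lemma cell_constr tau i A x : A \in samples tau i ->
  cell i.1.1 A (tau i.1) x -> constr tau i x.
Proof.
rewrite inE => /andP[_ /subsetP EA] h iD; apply: h; apply: EA.
by rewrite /wanted (negbTE iD) !inE eqxx orbT.
Qed.

Lemma cell_midpoint k A p x y : cell k A p x -> cell k A p y ->
  cell k A p ((x.1 + y.1) / 2, (x.2 + y.2) / 2).
Proof.
move=> hx hy z zA zp; have := hx z zA zp; have := hy z zA zp.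
set u := (_, _).
have := hdistB (beta k) (a p) (a z) u x; have := hdistB (beta k) (a p) (a z) u y.
by rewrite /u /=; lra.
Qed.

(** At most [m - 1] houses to avoid and two to contain give the exponent [m.+1]. *)
Lemma card_samples_type tau i : tau \in types ->
  (2 ^ n <= 2 ^ m.+1 * #|samples tau i|)%N.
Proof.
rewrite inE => /asboolP[x [gx xt]].
have [tD _] := typP a beta p0 mn x i.1.1 i.1.2.
rewrite -surjective_pairing xt in tD.
have DE : [disjoint trim i.1.2 & wanted tau i].
  rewrite disjoint_sym disjoints_subset; apply/subsetP => z.
  rewrite /wanted !inE => /predU1P[->//|].
  by case: ifP => zD; rewrite inE // => /eqP ->; rewrite zD.
have cE : (#|wanted tau i| <= 2)%N.
  rewrite /wanted; apply: leq_trans (leq_card_setU _ _) _; rewrite cards1.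
  by case: ifP; rewrite ?cards0 ?cards1.
have := card_samples DE; rewrite card_ord => /leq_trans; apply.
rewrite leq_mul2r leq_exp2l //; apply/orP; right.
by have := card_trim mn i.1.2; move: cE; move: #|_| #|_| => u v; lia.
Qed.

(** Otherwise, [r] being the infimum over all constraints, the open ball [sqnorm x < r] would meet
    every intersection of two constraints, hence by Helly's theorem all of them at once, contrary to
    the choice of [r]. *)
Lemma types_decided (k0 : K) (rep : type -> R * R) :
  (forall tau, tau \in types -> forall i, constr tau i (rep tau)) ->
  forall tau, tau \in types -> exists (r : R) i j,
    (forall x, constr tau i x -> constr tau j x -> r <= sqnorm x) /\
    forall e, 0 < e -> exists x, (forall i', constr tau i' x) /\ sqnorm x < r + e.
Proof.
move=> repP tau tauT.
have [|r [r1 r2]] := @sqnorm_inf R (fun x => forall i, constr tau i x).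
  by exists (rep tau); apply: repP.
exists r; apply: contrapT => h.
have [|i|||x [rx hx]] := @helly_relative R _ (k0, set0, p0) (constr tau)
  (fun x => sqnorm x < r).
- exact: convex4_ball.
- exact: convex4_constr.
- by exists (rep tau); apply: repP.
- move=> i j; apply: contrapT => hij; apply: h; exists i, j; split=> // x hi hj.
  by rewrite leNgt; apply/negP => xr; apply: hij; exists x.
by have := r1 x hx; rewrite leNgt rx.
Qed.

(* Two distinct types with the same two cells would have near-optimal points
   arbitrarily close to each other, by strict convexity of the norm, while some
   bisector separates their slackened cells by a positive distance. *)
Lemma type_unique (tau tau' : type) k k' p p' A A' (r r' : R) : 0 < d ->
  tau \in types -> tau' \in types ->
  (forall x, cell k A p x -> cell k' A' p' x -> r <= sqnorm x) ->
  (forall x, cell k A p x -> cell k' A' p' x -> r' <= sqnorm x) ->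
  (forall e, 0 < e -> exists x, [/\ forall i, constr tau i x,
     cell k A p x, cell k' A' p' x & sqnorm x < r + e]) ->
  (forall e, 0 < e -> exists x, [/\ forall i, constr tau' i x,
     cell k A p x, cell k' A' p' x & sqnorm x < r' + e]) ->
  tau = tau'.
Proof.
move=> d0; rewrite !inE => /asboolP[x [gx xt]] /asboolP[x' [gx' xt']] hr hr' hs hs'.
apply/ffunP => -[l D]; apply/eqP/negPn/negP => neq.
set q := tau (l, D) in neq; set q' := tau' (l, D) in neq.
have qD : q \notin trim D by rewrite /q -xt; have [] := typP a beta p0 mn x l D.
have q'D : q' \notin trim D by rewrite /q' -xt'; have [] := typP a beta p0 mn x' l D.
pose c := sqnorm ((a q).1 - (a q').1, (a q).2 - (a q').2).
have c0 : 0 <= c by apply: sqnorm_ge0.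
(* Chosen so that [4 * c * e < d ^ 2]: by Cauchy-Schwarz, two points at squared distance below
   [4 * e] cannot lie on opposite slackened sides of the bisector of [q] and [q']. *)
pose e := d ^+ 2 / (4 * (c + 1)).
have d20 : 0 < d ^+ 2 by rewrite exprn_gt0.
have c1 : 0 < 4 * (c + 1) by lra.
have e0 : 0 < e by rewrite divr_gt0.
have [u [cu ku ku' ur]] := hs e e0; have [v [cv kv kv' vr]] := hs' e e0.
have := hr _ (cell_midpoint ku kv) (cell_midpoint ku' kv').
have := hr' _ (cell_midpoint ku kv) (cell_midpoint ku' kv').
set w := (_, _) => wr' wr.
(* Parallelogram law; the midpoint [w] lies in both cells, so [sqnorm w] is at least [r] and
   [r']. *)
have uv4 : sqnorm (u.1 - v.1, u.2 - v.2) < 4 * e.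
  have : sqnorm (u.1 - v.1, u.2 - v.2) =
      2 * (sqnorm u + sqnorm v) - 4 * sqnorm w.
    by rewrite /sqnorm /w /=; field.
  lra.
have neq' : q' != q by rewrite eq_sym.
have hu : hdist (beta l) (a q) u + d <= hdist (beta l) (a q') u.
  exact: (cu (l, D, q') q'D neq').
have hv : hdist (beta l) (a q') v + d <= hdist (beta l) (a q) v.
  exact: (cv (l, D, q) qD neq).
have := hdistB (beta l) (a q) (a q') u v.
set s := (X in _ = 2 * X) => hs2.
have sd : d <= s by lra.
have cs : s ^+ 2 <= c * sqnorm (u.1 - v.1, u.2 - v.2).
  rewrite -subr_ge0 /c /s /sqnorm /=.
  have -> : forall y z y' z' : R, (y ^+ 2 + z ^+ 2) * (y' ^+ 2 + z' ^+ 2)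
     - (y * y' + z * z') ^+ 2 = (y * z' - z * y') ^+ 2 by move=> *; ring.
  exact: sqr_ge0.
have ds : d ^+ 2 <= s ^+ 2 by rewrite ler_sqr ?nnegrE //; lra.
have ce : c * sqnorm (u.1 - v.1, u.2 - v.2) <= c * (4 * e).
  by rewrite ler_wpM2l // ltW.
have eE : d ^+ 2 = 4 * c * e + 4 * e.
  by rewrite /e; field; rewrite gt_eqF //; lra.
lra.
Qed.

End TypeCount.
(** Double counting of types with one sample for each of their two deciding constraints. A type has
    at least [(2 ^ n / 2 ^ m.+1) ^ 2] pairs of samples, while two agents, two samples and two
    nearest houses determine the type by [type_unique]. *)
Lemma card_types (R : realType) (n m : nat) (K : finType)
    (a : 'I_n -> R * R) (beta : K -> R * R) (p0 : 'I_n) (k0 : K) :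
  (0 < m <= n)%N ->
  (#|types m a beta p0| <= 4 ^ m.+1 * (#|K| ^ 2 * n ^ 2))%N.
Proof.
move=> mn; set T := types m a beta p0.
have [rep repP] : exists rep : _ -> R * R, forall tau, tau \in T ->
    generic a beta (rep tau) /\ typ m a beta p0 (rep tau) = tau.
  have [|rep repP] := @choice _ _ (fun tau x => tau \in T ->
      generic a beta x /\ typ m a beta p0 x = tau); last by exists rep.
  move=> tau; have [|nT] := boolP (tau \in T); last by exists (0, 0).
  by rewrite inE => /asboolP[x h]; exists x.
(* One slack for all types: [d] is at most every positive difference of squared distances at the
   representatives, and genericity makes the relevant differences positive. *)
have [d [d0 gap]] := uniform_gap (fun z : {ffun K * {set 'I_n} -> 'I_n} *
  (K * {set 'I_n} * 'I_n) => hdist (beta z.2.1.1) (a z.2.2) (rep z.1) -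
  hdist (beta z.2.1.1) (a (z.1 z.2.1)) (rep z.1)).
have constr_rep tau : tau \in T -> forall i, constr m a beta d tau i (rep tau).
  move=> /repP[gx xt] [[k D] q] /= qD qt.
  have [_ /(_ _ qD)] := typP a beta p0 mn (rep tau) k D.
  rewrite xt le_eqVlt (negbTE (gx _ _ _ _)) 1?eq_sym //= => lt.
  by have := gap (tau, (k, D, q)); rewrite /= subr_gt0 => /(_ lt); lra.
have [sel selP] : exists sel : {ffun K * {set 'I_n} -> 'I_n} ->
    R * (K * {set 'I_n} * 'I_n) * (K * {set 'I_n} * 'I_n),
    forall tau, tau \in T -> let: (r, i, j) := sel tau in
    (forall x, constr m a beta d tau i x -> constr m a beta d tau j x ->
      r <= sqnorm x) /\
    forall e, 0 < e -> exists x, (forall i', constr m a beta d tau i' x) /\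
      sqnorm x < r + e.
  have [|sel selP] := @choice _ _ (fun tau (s : R * (K * {set 'I_n} * 'I_n) *
      (K * {set 'I_n} * 'I_n)) => tau \in T -> let: (r, i, j) := s in
    (forall x, constr m a beta d tau i x -> constr m a beta d tau j x ->
      r <= sqnorm x) /\
    forall e, 0 < e -> exists x, (forall i', constr m a beta d tau i' x) /\
      sqnorm x < r + e); last by exists sel.
  move=> tau; have [tT|nT] := boolP (tau \in T); last by exists (0, (k0, set0, p0), (k0, set0, p0)).
  have [r [i [j h]]] := types_decided k0 constr_rep tT.
  by exists (r, i, j).
pose S1 tau := samples m tau (sel tau).1.2; pose S2 tau := samples m tau (sel tau).2.
pose Z := [set z | (z.1 \in T) && (z.2 \in setX (S1 z.1) (S2 z.1))].
have ltZ : (4 ^ n * #|T| <= 4 ^ m.+1 * #|Z|)%N.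
  have -> : #|Z| = (\sum_(tau in T) #|setX (S1 tau) (S2 tau)|)%N.
    under eq_bigr do rewrite -sum1_card.
    by rewrite pair_big_dep /= -sum1_card; apply: eq_bigl => z; rewrite inE.
  rewrite mulnC -sum_nat_const big_distrr /=; apply: leq_sum => tau tT.
  rewrite cardsX -[4%N]/(2 * 2)%N !expnMn mulnACA.
  by apply: leq_mul; apply: card_samples_type tT.
pose phi (z : {ffun K * {set 'I_n} -> 'I_n} * ({set 'I_n} * {set 'I_n})) :=
  (((sel z.1).1.2.1.1, (sel z.1).2.1.1), z.2,
   (z.1 (sel z.1).1.2.1, z.1 (sel z.1).2.1)).
have leZ : (#|Z| <= 4 ^ n * (#|K| ^ 2 * n ^ 2))%N.
  rewrite -(@card_in_imset _ _ phi).
    have cP : #|{: {set 'I_n}}| = (2 ^ n)%N.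
      by rewrite -cardsT -powersetT card_powerset cardsT card_ord.
    apply: leq_trans (max_card _) _; rewrite !card_prod card_ord cP.
    by rewrite -[4%N]/(2 * 2)%N expnMn -!mulnn; lia.
  move=> [tau [A B]] [tau' [A' B']].
  rewrite in_set /= in_setX => /and3P[tT AS BS].
  rewrite in_set /= in_setX => /and3P[tT' AS' BS'].
  rewrite /phi /= => -[ek ek' eA eB ep ep']; subst A' B'.
  congr pair; move: (selP _ tT) (selP _ tT').
  move: AS BS AS' BS' ek ek' ep ep'; rewrite /S1 /S2.
  case: (sel tau) => [[r i] j]; case: (sel tau') => [[r' i'] j'] /=.
  move=> AS BS AS' BS' ek ek' ep ep' [h1 h2] [h1' h2'].
  apply: (@type_unique R n m K a beta p0 d mn tau tau' i.1.1 j.1.1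
    (tau i.1) (tau j.1) A B r r') => //.
  - by move=> x cx cx'; apply: h1; apply: cell_constr; eassumption.
  - move=> x cx cx'; apply: h1'.
      by apply: (cell_constr AS'); rewrite -ek -ep.
    by apply: (cell_constr BS'); rewrite -ek' -ep'.
  - move=> e /h2[x [cx xr]]; exists x; split=> //.
      exact: constr_cell AS cx.
    exact: constr_cell BS cx.
  - move=> e /h2'[x [cx xr]]; exists x; split=> //.
      by rewrite ek ep; apply: constr_cell AS' cx.
    by rewrite ek' ep'; apply: constr_cell BS' cx.
have := leq_trans ltZ (leq_mul (leqnn _) leZ).
by rewrite mulnCA leq_pmul2l // expn_gt0.
Qed.
(** * Optimal matchings near a translation *)

Definition eventually {R : realType} (P : R -> Prop) : Prop :=
  exists e : R, 0 < e /\ forall h, 0 < h < e -> P h.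

Lemma eventually_and (R : realType) (P Q : R -> Prop) :
  eventually P -> eventually Q -> eventually (fun h => P h /\ Q h).
Proof.
move=> [e [e0 eP]] [f [f0 fQ]]; exists (Num.min e f); split.
  by rewrite lt_min e0.
move=> h /andP[h0]; rewrite lt_min => /andP[he hf].
by split; [apply: eP|apply: fQ]; rewrite h0.
Qed.

Lemma eventually_all (R : realType) (I : finType) (P : I -> R -> Prop) :
  (forall i, eventually (P i)) -> eventually (fun h => forall i, P i h).
Proof.
move=> /choice[e eP]; have [d [d0 de]] := uniform_gap e.
exists d; split=> // h /andP[h0 hd] i; have [ei0 ePi] := eP i.
by apply: ePi; rewrite h0 (lt_le_trans hd) // de.
Qed.

Lemma eventually_witness (R : realType) (P : R -> Prop) : eventually P -> exists h, P h.
Proof. by move=> [e [e0 eP]]; exists (e / 2); apply: eP; lra. Qed.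

(* The sign of [A + h * B + h ^ 2 * C] for infinitesimal [h > 0]. *)
Definition lexpos {R : realType} (A B C : R) : Prop :=
  0 < A \/ (A = 0 /\ (0 < B \/ (B = 0 /\ 0 < C))).

Lemma lexpos_trichotomy (R : realType) (A B C : R) :
  [\/ lexpos A B C, lexpos (- A) (- B) (- C) | [/\ A = 0, B = 0 & C = 0]].
Proof.
rewrite /lexpos; have [A0|A0|->] := ltrgtP A 0.
- by apply: Or32; left; lra.
- by apply: Or31; left.
have [B0|B0|->] := ltrgtP B 0.
- by apply: Or32; right; split; [lra|left; lra].
- by apply: Or31; right; split; [lra|left].
have [C0|C0|->] := ltrgtP C 0.
- by apply: Or32; right; split; [lra|right; split; lra].
- by apply: Or31; right; split=> //; right.
- by apply: Or33.
Qed.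

Lemma eventually_lexpos (R : realType) (A B C : R) :
  lexpos A B C -> eventually (fun h => 0 < A + h * B + h ^+ 2 * C).
Proof.
have nB := ler_norm (- B); have nC := ler_norm (- C); rewrite !normrN in nB nC.
have B0 := normr_ge0 B; have C0 := normr_ge0 C.
case=> [A0|[-> [Bp|[-> Cp]]]].
- have s0 : 0 < `|B| + `|C| + 1 by lra.
  exists (Num.min 1 (A / (`|B| + `|C| + 1))); split.
    by rewrite lt_min ltr01 divr_gt0.
  move=> h /andP[h0]; rewrite lt_min ltr_pdivlMr // => /andP[h1 hA].
  have h2 : h ^+ 2 <= h by nra.
  have e1 : h * - B <= h * `|B| by rewrite ler_wpM2l // ltW.
  have e2 : h ^+ 2 * - C <= h ^+ 2 * `|C| by rewrite ler_wpM2l // sqr_ge0.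
  have e3 : h ^+ 2 * `|C| <= h * `|C| by rewrite ler_wpM2r.
  lra.
- have s0 : 0 < `|C| + 1 by lra.
  exists (B / (`|C| + 1)); split; first by rewrite divr_gt0.
  move=> h /andP[h0]; rewrite ltr_pdivlMr // => hB.
  have -> : 0 + h * B + h ^+ 2 * C = h * (B + h * C) by ring.
  apply: mulr_gt0 => //.
  have : h * - C <= h * `|C| by rewrite ler_wpM2l // ltW.
  lra.
exists 1; split=> // h /andP[h0 _]; rewrite mulr0 !add0r.
by rewrite mulr_gt0 // exprn_gt0.
Qed.

(** For small [h > 0] this leaves [t] in direction [u], tilted infinitesimally towards [w], so that
    [w] breaks the ties left by [u]. *)
Definition curve {R : realType} (t u w : R * R) (h : R) : R * R :=
  (t.1 + h * u.1 + h ^+ 2 * w.1, t.2 + h * u.2 + h ^+ 2 * w.2).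

Section Matchings.
Variables (R : realType) (n m : nat) (a : 'I_n -> R * R) (b : 'I_m -> R * R).
Hypothesis a_inj : injective a.
Hypothesis mn : (0 < m <= n)%N.
Implicit Types pi sigma : {ffun 'I_m -> 'I_n}.
Local Notation opt := (opt_matchings a b).
Local Notation cost := (match_cost a b).

Definition dotp (u v : R * R) : R := u.1 * v.1 + u.2 * v.2.

(* Half of [d_pi], up to a constant independent of [pi]. *)
Definition grad pi : R * R := (- \sum_i (a (pi i)).1, - \sum_i (a (pi i)).2).

(** The quadratic term is common to all matchings and cancels, as do the contributions of the
    [b i]. *)
Lemma costB pi sigma x y :
  (cost pi x - cost sigma x) - (cost pi y - cost sigma y) =
  2 * (((grad pi).1 - (grad sigma).1) * (x.1 - y.1) +
       ((grad pi).2 - (grad sigma).2) * (x.2 - y.2)).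
Proof.
rewrite /match_cost -!sumrB.
under eq_bigr => i _ do rewrite (hdistB (b i) (a (sigma i)) (a (pi i)) x y).
rewrite -mulr_sumr big_split /= -!mulr_suml !sumrB /grad /=; ring.
Qed.

Lemma cost_curve pi sigma t u w h :
  cost pi (curve t u w h) - cost sigma (curve t u w h) =
  (cost pi t - cost sigma t)
  + h * (2 * (dotp (grad pi) u - dotp (grad sigma) u))
  + h ^+ 2 * (2 * (dotp (grad pi) w - dotp (grad sigma) w)).
Proof.
have := costB pi sigma (curve t u w h) t.
have -> : (curve t u w h).1 - t.1 = h * u.1 + h ^+ 2 * w.1 by rewrite /=; ring.
have -> : (curve t u w h).2 - t.2 = h * u.2 + h ^+ 2 * w.2 by rewrite /=; ring.
move/eqP; rewrite subr_eq => /eqP ->; rewrite /dotp; ring.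
Qed.

Lemma optP pi t : reflect (injective pi /\ forall sigma, injective sigma ->
  cost pi t <= cost sigma t) (pi \in opt t).
Proof.
rewrite inE; apply: (iffP andP) => [[/injectiveP ip /forallP h]|[ip h]]; split=> //.
- by move=> sigma /injectiveP is_; have := h sigma; rewrite is_.
- exact/injectiveP.
- by apply/forallP => sigma; apply/implyP => /injectiveP; apply: h.
Qed.

Lemma opt_cost_eq pi sigma t : pi \in opt t -> sigma \in opt t -> cost pi t = cost sigma t.
Proof.
move=> /optP[ip hp] /optP[is_ hs]; apply/le_anti.
by rewrite hp // hs.
Qed.

Lemma opt_transfer pi sigma t : pi \in opt t -> injective sigma ->
  cost sigma t = cost pi t -> sigma \in opt t.
Proof.
by move=> /optP[ip hp] is_ e; apply/optP; split=> // rho ir; rewrite e hp.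
Qed.

Lemma opt_nonempty t : exists pi, pi \in opt t.
Proof.
have [_ le_mn] := andP mn.
pose w : {ffun 'I_m -> 'I_n} := [ffun i => widen_ord le_mn i].
have iw : injectiveb w.
  by apply/injectiveP => i j; rewrite !ffunE => /(congr1 val) /= /val_inj.
exists [arg min_(p < w | injectiveb p) cost p t]%O.
case: arg_minP => // p ip h; rewrite inE ip; apply/forallP => s; apply/implyP; exact: h.
Qed.

Definition lex_below pi u w (S : {set {ffun 'I_m -> 'I_n}}) : Prop :=
  forall sigma, sigma \in S ->
    dotp (grad pi) u < dotp (grad sigma) u \/
    (dotp (grad pi) u = dotp (grad sigma) u /\ dotp (grad pi) w <= dotp (grad sigma) w).

(** Each of the finitely many cost differences takes, for small [h > 0], the sign of its first
    nonzero coefficient. *)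
Lemma opt_curve t u w : eventually (fun h => forall pi, pi \in opt (curve t u w h) ->
  pi \in opt t /\ lex_below pi u w (opt t)).
Proof.
have : eventually (fun h => forall ps : {ffun 'I_m -> 'I_n} * {ffun 'I_m -> 'I_n},
    cost ps.1 (curve t u w h) <= cost ps.2 (curve t u w h) ->
    ~ lexpos (cost ps.1 t - cost ps.2 t)
       (2 * (dotp (grad ps.1) u - dotp (grad ps.2) u))
       (2 * (dotp (grad ps.1) w - dotp (grad ps.2) w))).
  apply: eventually_all => -[pi sigma] /=.
  have [lp|nlp] := pselect (lexpos (cost pi t - cost sigma t)
       (2 * (dotp (grad pi) u - dotp (grad sigma) u))
       (2 * (dotp (grad pi) w - dotp (grad sigma) w))); last first.
    by exists 1; split.
  have [e [e0 he]] := eventually_lexpos lp.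
  exists e; split=> // h /he; rewrite -cost_curve => ? ? _; lra.
move=> [e [e0 he]]; exists e; split=> // h /he {}he pi /optP[ip hp].
have key sigma : injective sigma -> ~ lexpos (cost pi t - cost sigma t)
       (2 * (dotp (grad pi) u - dotp (grad sigma) u))
       (2 * (dotp (grad pi) w - dotp (grad sigma) w)).
  by move=> is_; apply: (he (pi, sigma)); apply: hp.
have pt : pi \in opt t.
  apply/optP; split=> // sigma /key k; rewrite leNgt; apply/negP => lt.
  by apply: k; left; lra.
split=> // sigma st; have /optP[is_ _] := st; have := key _ is_.
rewrite (opt_cost_eq pt st) subrr => k.
have [lt|gt|e'] := ltrgtP (dotp (grad pi) u) (dotp (grad sigma) u); [by left| |].
  by case: k; right; split=> //; left; lra.
right; split=> //; rewrite leNgt; apply/negP => lt.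
by apply: k; right; split=> //; right; lra.
Qed.

(** If a bisector contained the curve, its normal [a p - a q] would be orthogonal to the independent
    vectors [u] and [w], hence zero. *)
Lemma generic_curve t u w : u.1 * w.2 - u.2 * w.1 != 0 ->
  eventually (fun h => generic a b (curve t u w h)).
Proof.
move=> uw; have : eventually (fun h => forall z : 'I_m * 'I_n * 'I_n,
    z.1.2 != z.2 -> hdist (b z.1.1) (a z.1.2) (curve t u w h) !=
                    hdist (b z.1.1) (a z.2) (curve t u w h)).
  apply: eventually_all => -[[k p] q] /=.
  have [->|npq] := eqVneq p q; first by exists 1; split.
  pose c := ((a p).1 - (a q).1, (a p).2 - (a q).2).
  pose A := hdist (b k) (a q) t - hdist (b k) (a p) t.
  have E h : hdist (b k) (a q) (curve t u w h) - hdist (b k) (a p) (curve t u w h) =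
      A + h * (2 * dotp c u) + h ^+ 2 * (2 * dotp c w).
    have := hdistB (b k) (a p) (a q) (curve t u w h) t.
    by rewrite -/A /curve /dotp /c /= => e; lra.
  have [lp|ln|[_ z1 z2]] := lexpos_trichotomy A (2 * dotp c u) (2 * dotp c w).
  - have [e [e0 he]] := eventually_lexpos lp; exists e; split=> // h /he.
    by rewrite -E => lt _; apply/eqP; lra.
  - have [e [e0 he]] := eventually_lexpos ln; exists e; split=> // h /he hlt _.
    by apply/eqP; have := E h; lra.
  case/eqP: npq; apply: a_inj; move: z1 z2; rewrite /dotp => z1 z2.
  have c1 : c.1 = 0.
    apply/eqP; rewrite -(mulIr_eq0 _ (mulIf uw)); apply/eqP.
    have -> : c.1 * (u.1 * w.2 - u.2 * w.1) =
      w.2 * (c.1 * u.1 + c.2 * u.2) - u.2 * (c.1 * w.1 + c.2 * w.2) by ring.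
    have -> : c.1 * u.1 + c.2 * u.2 = 0 by lra.
    have -> : c.1 * w.1 + c.2 * w.2 = 0 by lra.
    by rewrite !mulr0 subrr.
  have c2 : c.2 = 0.
    apply/eqP; rewrite -(mulIr_eq0 _ (mulIf uw)); apply/eqP.
    have -> : c.2 * (u.1 * w.2 - u.2 * w.1) =
      u.1 * (c.1 * w.1 + c.2 * w.2) - w.1 * (c.1 * u.1 + c.2 * u.2) by ring.
    have -> : c.1 * u.1 + c.2 * u.2 = 0 by lra.
    have -> : c.1 * w.1 + c.2 * w.2 = 0 by lra.
    by rewrite !mulr0 subrr.
  rewrite (surjective_pairing (a p)) (surjective_pairing (a q)).
  by congr pair; apply/eqP; rewrite -subr_eq0; apply/eqP.
move=> [e [e0 he]]; exists e; split=> // h /he {}he k p q; exact: (he (k, p, q)).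
Qed.

End Matchings.
(** Eliminating [x] writes [(p1 * q2 - p2 * q1) * y] as [p1] times the second scalar product minus
    [q1] times the first, where [p1 <= 0 < q1]. *)
Lemma cone_below (R : realType) (p1 p2 q1 q2 x y : R) :
  p1 < 0 \/ (p1 = 0 /\ p2 <= 0) -> 0 < q1 \/ (q1 = 0 /\ 0 <= q2) ->
  0 < p1 * q2 - p2 * q1 ->
  0 <= p1 * x + p2 * y -> 0 <= q1 * x + q2 * y -> y <= 0 /\ (y = 0 -> 0 <= x).
Proof.
move=> hp hq c hx hy.
have q0 : 0 < q1.
  case: hq => [//|[q10 q20]]; subst q1; exfalso; case: hp => [p0|[p0 p0']]; last by subst p1; lra.
  by have := mulr_ge0 (ltW (_ : 0 < - p1)) q20; rewrite oppr_gt0 => /(_ p0); lra.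
have pn : p1 <= 0 by case: hp => [/ltW//|[-> _]].
have yn : (p1 * q2 - p2 * q1) * y <= 0.
  have e1 : 0 <= - p1 * (q1 * x + q2 * y) by rewrite mulr_ge0 ?oppr_ge0.
  have e2 : 0 <= q1 * (p1 * x + p2 * y) by rewrite mulr_ge0 // ltW.
  by apply: (@le_trans _ _ (p1 * (q1 * x + q2 * y) - q1 * (p1 * x + p2 * y))); lra.
split; first by move: yn; rewrite pmulr_rle0.
by move=> y0; subst y; move: hy; rewrite mulr0 addr0 pmulr_rge0.
Qed.

Lemma cone_above (R : realType) (p1 p2 q1 q2 x y : R) :
  p1 < 0 \/ (p1 = 0 /\ p2 <= 0) -> 0 < q1 \/ (q1 = 0 /\ 0 <= q2) ->
  p1 * q2 - p2 * q1 < 0 ->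
  0 <= p1 * x + p2 * y -> 0 <= q1 * x + q2 * y -> 0 <= y /\ (y = 0 -> x <= 0).
Proof.
move=> hp hq c hx hy.
have [] := @cone_below R (- q1) (- q2) (- p1) (- p2) (- x) (- y).
- case: hq => [q0|[-> q0]]; [by left; lra|by right; split; lra].
- case: hp => [p0|[-> p0]]; [by left; lra|by right; split; lra].
- lra.
- lra.
- lra.
by move=> y0 yx; split=> [|e]; [lra|have := yx; rewrite e oppr0 => /(_ erefl); lra].
Qed.

(** * Recovering cells from nearby optimal matchings *)

Section Cells.
Variables (R : realType) (n m : nat) (a : 'I_n -> R * R) (b : 'I_m -> R * R).
Hypothesis mn : (0 < m <= n)%N.
Implicit Types pi sigma : {ffun 'I_m -> 'I_n}.
Local Notation opt := (opt_matchings a b).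
Local Notation cost := (match_cost a b).
Local Notation grad := (grad a).
Local Notation e1 := ((1, 0) : R * R).
Local Notation e2 := ((0, 1) : R * R).
Local Notation me1 := ((-1, 0) : R * R).
Local Notation me2 := ((0, -1) : R * R).

(** Equal images give equal gradients, so the costs differ by a constant; optimality of each
    matching somewhere makes it zero. *)
Lemma same_image_cost pi sigma y z : pi \in opt y -> sigma \in opt z ->
  [set pi i | i : 'I_m] = [set sigma i | i : 'I_m] -> forall x, cost pi x = cost sigma x.
Proof.
move=> py sz im x; have /optP[ip hp] := py; have /optP[is_ hs] := sz.
have sumE (f : 'I_n -> R) : \sum_i f (pi i) = \sum_i f (sigma i).
  transitivity (\sum_(j in [set pi i | i : 'I_m]) f j).
    by rewrite big_imset //=; move=> ? ? _ _; apply: ip.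
  by rewrite im big_imset //=; move=> ? ? _ _; apply: is_.
have gE : grad pi = grad sigma.
  by rewrite /grad (sumE (fun j => (a j).1)) (sumE (fun j => (a j).2)).
have := costB a b pi sigma x y; have := costB a b pi sigma x z.
have := hp _ is_; have := hs _ ip; rewrite gE !subrr; lra.
Qed.

Definition cross (u v : R * R) : R := u.1 * v.2 - u.2 * v.1.

Definition gradB pi sigma : R * R :=
  ((grad pi).1 - (grad sigma).1, (grad pi).2 - (grad sigma).2).

Lemma opt_gradB pi sigma t t' : pi \in opt t -> sigma \in opt t ->
  cost sigma t' <= cost pi t' -> 0 <= dotp (gradB pi sigma) (t'.1 - t.1, t'.2 - t.2).
Proof.
move=> pt st le; have := costB a b pi sigma t' t; rewrite (opt_cost_eq pt st) subrr subr0.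
by rewrite /dotp /gradB /=; lra.
Qed.

Lemma lex_min_gradB pi sigma S : lex_below a pi e1 e2 S -> sigma \in S ->
  (gradB pi sigma).1 < 0 \/ ((gradB pi sigma).1 = 0 /\ (gradB pi sigma).2 <= 0).
Proof.
move=> h /h; rewrite /dotp /gradB /= !mulr0 !mulr1 !addr0 !add0r.
by case=> [|[-> ?]]; [left|right; split]; lra.
Qed.

Lemma lex_max_gradB pi sigma S : lex_below a pi me1 me2 S -> sigma \in S ->
  0 < (gradB pi sigma).1 \/ ((gradB pi sigma).1 = 0 /\ 0 <= (gradB pi sigma).2).
Proof.
move=> h /h; rewrite /dotp /gradB /= !mulr0 !mulrN1 !addr0 !add0r.
by case=> [|[? ?]]; [left|right; split]; lra.
Qed.

(* The region of [pi3] lies on one side of the (infinitesimally tilted)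
   horizontal line through the vertex [t], so [t] is its extreme point. *)
Lemma vertex_unique (t t' : R * R) pi1 pi2 pi3 pi1' pi2' pi3' (s : bool) :
  pi1 \in opt t -> pi2 \in opt t -> pi3 \in opt t ->
  pi1' \in opt t' -> pi2' \in opt t' -> pi3' \in opt t' ->
  lex_below a pi1 e1 e2 (opt t) -> lex_below a pi2 me1 me2 (opt t) ->
  lex_below a pi1' e1 e2 (opt t') -> lex_below a pi2' me1 me2 (opt t') ->
  0 < (-1) ^+ s * cross (gradB pi2 pi1) (gradB pi3 pi1) ->
  0 < (-1) ^+ s * cross (gradB pi2' pi1') (gradB pi3' pi1') ->
  (forall x, cost pi3 x = cost pi3' x) -> t = t'.
Proof.
move=> o1 o2 o3 o1' o2' o3' l1 l2 l1' l2' c c' E.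
pose x := t'.1 - t.1; pose y := t'.2 - t.2.
have min t0 p q : p \in opt t0 -> q \in opt t -> cost p t0 <= cost q t0.
  by move=> /optP[_ h] /optP[? _]; apply: h.
have min' t0 p q : p \in opt t0 -> q \in opt t' -> cost p t0 <= cost q t0.
  by move=> /optP[_ h] /optP[? _]; apply: h.
have d1 : 0 <= dotp (gradB pi1 pi3) (x, y) by apply: opt_gradB => //; rewrite E min.
have d2 : 0 <= dotp (gradB pi2 pi3) (x, y) by apply: opt_gradB => //; rewrite E min.
have d1' : 0 <= dotp (gradB pi1' pi3') (- x, - y).
  by rewrite /x /y !opprB; apply: opt_gradB => //; rewrite -E min'.
have d2' : 0 <= dotp (gradB pi2' pi3') (- x, - y).
  by rewrite /x /y !opprB; apply: opt_gradB => //; rewrite -E min'.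
have p := lex_min_gradB l1 o3; have q := lex_max_gradB l2 o3.
have p' := lex_min_gradB l1' o3'; have q' := lex_max_gradB l2' o3'.
have crossE p1 p2 p3 : cross (gradB p2 p1) (gradB p3 p1) =
    (gradB p1 p3).1 * (gradB p2 p3).2 - (gradB p1 p3).2 * (gradB p2 p3).1.
  by rewrite /cross /gradB /=; ring.
rewrite !crossE in c c'; rewrite /dotp /= in d1 d2 d1' d2'.
have [y0 x0] : y = 0 /\ x = 0.
  case: s c c'; rewrite ?expr1 ?expr0 ?mulN1r ?mul1r ?oppr_gt0 => c c'.
    have [h1 h2] := cone_above p q c d1 d2.
    have [h3 h4] := cone_above p' q' c' d1' d2'.
    have y0 : y = 0 by lra.
    by split=> //; have := h2 y0; have := h4; rewrite y0 oppr0 => /(_ erefl); lra.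
  have [h1 h2] := cone_below p q c d1 d2.
  have [h3 h4] := cone_below p' q' c' d1' d2'.
  have y0 : y = 0 by lra.
  by split=> //; have := h2 y0; have := h4; rewrite y0 oppr0 => /(_ erefl); lra.
rewrite (surjective_pairing t) (surjective_pairing t').
by congr pair; rewrite /x /y in x0 y0; lra.
Qed.

(** [pi1] and [pi2] have the lexicographically least and greatest gradients, so for [S = opt t] the
    condition is that all optimal gradients are collinear: it holds on regions and edges and fails
    at vertices. *)
Definition flat (S : {set {ffun 'I_m -> 'I_n}}) : Prop := forall pi1 pi2 sigma,
  pi1 \in S -> pi2 \in S -> sigma \in S ->
  lex_below a pi1 e1 e2 S -> lex_below a pi2 me1 me2 S ->
  cross (gradB pi2 pi1) (gradB sigma pi1) = 0.

(** In a flat cell every optimal gradient is an affine combination of the two extreme ones, so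
    wherever both extremes are optimal, all of [opt t] is. *)
Lemma flat_subset (t t' : R * R) pi1 pi2 : flat (opt t) ->
  pi1 \in opt t -> pi2 \in opt t -> pi1 \in opt t' -> pi2 \in opt t' ->
  lex_below a pi1 e1 e2 (opt t) -> lex_below a pi2 me1 me2 (opt t) ->
  opt t \subset opt t'.
Proof.
move=> fl o1 o2 o1' o2' l1 l2; apply/subsetP => sigma os.
have /optP[is_ _] := os.
have cr := fl _ _ _ o1 o2 os l1 l2; have p := lex_min_gradB l1 os; have q := lex_max_gradB l2 os.
have p12 := lex_min_gradB l1 o2.
apply: (opt_transfer o1' is_); apply/eqP; rewrite -subr_eq0; apply/eqP.
have := costB a b sigma pi1 t' t; have := costB a b pi2 pi1 t' t.
rewrite (opt_cost_eq o2' o1') (opt_cost_eq os o1) (opt_cost_eq o2 o1) !subrr !subr0.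
move: cr p q p12; rewrite /cross /gradB.
move: (grad pi1) (grad pi2) (grad sigma) => [C D] [A B] [E F] /=.
set x := t'.1 - t.1; set y := t'.2 - t.2; set z := cost sigma t' - cost pi1 t'.
move=> cr p q p12 h hz.
have [AC|AC] := eqVneq A C; last first.
  apply/eqP; rewrite -(mulIr_eq0 _ (mulIf (_ : A - C != 0))) ?subr_eq0 //; apply/eqP.
  rewrite hz.
  transitivity ((E - C) * (2 * ((A - C) * x + (B - D) * y)) + 2 * y *
    ((A - C) * (F - D) - (B - D) * (E - C))); first by ring.
  by rewrite -h cr !mulr0 addr0.
have EC : E = C by lra.
have [BD|BD] := eqVneq B D.
  have FD : F = D by lra.
  by rewrite hz EC FD; lra.
have y0 : y = 0.
  apply/eqP; rewrite -(mulIr_eq0 _ (mulIf (_ : B - D != 0))) ?subr_eq0 //; apply/eqP.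
  by move: h; rewrite AC subrr mul0r add0r => h; lra.
by rewrite hz EC y0 subrr mul0r mulr0 addr0 mulr0.
Qed.

Lemma opt_stable (K : finType) (beta : K -> R * R) (p0 : 'I_n) (e : 'I_m -> K) x y pi :
  (forall i p, hdist (beta (e i)) (a p) x = hdist (b i) (a p) y) ->
  generic a beta x -> pi \in opt y ->
  stable_matching (fun i D => typ m a beta p0 x (e i, D)) pi [set pi i | i : 'I_m].
Proof.
move=> he gx /optP[ip hp]; split=> // i D Dm; set q := typ _ _ _ _ _ _ => qS.
apply/negPn/negP => pD.
have [_ h] := typP a beta p0 mn x (e i) D.
have qi j : pi j != q by apply: contraNneq qS => <-; apply: imset_f.
have {}h : hdist (b i) (a q) y < hdist (b i) (a (pi i)) y.
  rewrite -!he lt_def gx //=; apply: h.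
  by rewrite /trim Dm.
pose sigma : {ffun 'I_m -> 'I_n} := [ffun j => if j == i then q else pi j].
have is_ : injective sigma.
  move=> j k; rewrite !ffunE; case: eqP => [->|_]; case: eqP => [->|_] //.
  - by move=> /esym/eqP; rewrite (negbTE (qi k)).
  - by move=> /eqP; rewrite (negbTE (qi j)).
  - exact: ip.
have := hp _ is_; apply/negP; rewrite -ltNge /match_cost.
rewrite (bigD1 i) //= [ltRHS](bigD1 i) //= ffunE eqxx; apply: ltr_leD => //.
by apply: ler_sum => j ji; rewrite ffunE (negbTE ji).
Qed.

End Cells.
(** * Counting cells *)

Lemma card_fibers (T U : finType) (A : {set T}) (B : T -> {set U}) (c : nat) :
  (forall t, t \in A -> (#|B t| <= c)%N) ->
  (#|[set z | (z.1 \in A) && (z.2 \in B z.1)]| <= #|A| * c)%N.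
Proof.
move=> h; have -> : #|[set z | (z.1 \in A) && (z.2 \in B z.1)]| = (\sum_(t in A) #|B t|)%N.
  under eq_bigr do rewrite -sum1_card.
  by rewrite pair_big_dep /= -sum1_card; apply: eq_bigl => z; rewrite inE.
by rewrite -sum_nat_const; apply: leq_sum.
Qed.

Section Complexity.
Variables (R : realType) (n m : nat) (a : 'I_n -> R * R) (b : 'I_m -> R * R).
Hypothesis a_inj : injective a.
Hypothesis mn : (0 < m <= n)%N.
Variable p0 : 'I_n.
Variable k0 : 'I_m.
Local Notation opt := (opt_matchings a b).
Local Notation e1 := ((1, 0) : R * R).
Local Notation e2 := ((0, 1) : R * R).
Local Notation me1 := ((-1, 0) : R * R).
Local Notation me2 := ((0, -1) : R * R).
Local Notation flat := (flat a).
Implicit Types (S : {set {ffun 'I_m -> 'I_n}}) (t : R * R).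

Definition cells : {set {set {ffun 'I_m -> 'I_n}}} :=
  [set S | `[< exists t, S = opt t >]].

Definition images (K : finType) (e : 'I_m -> K)
    (tau : {ffun K * {set 'I_n} -> 'I_n}) : {set {set 'I_n}} :=
  [set I | `[< exists pi, stable_matching (fun i D => tau (e i, D)) pi I >]].

Lemma card_images (K : finType) (beta : K -> R * R) (e : 'I_m -> K) tau :
  tau \in types m a beta p0 -> (#|images e tau| <= 4 ^ m)%N.
Proof.
rewrite inE => /asboolP[x [_ <-]]; apply: card_stable_images => i D Dm.
by have [+ _] := typP a beta p0 mn x (e i) D; rewrite /trim Dm.
Qed.

Lemma cell_points : exists pt : {set {ffun 'I_m -> 'I_n}} -> R * R,
  forall S, S \in cells -> S = opt (pt S).
Proof.
have [|pt h] := @choice _ _ (fun S t => S \in cells -> S = opt t); last by exists pt.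
move=> S; have [|] := boolP (S \in cells); last by exists (0, 0).
by rewrite inE => /asboolP[t ->]; exists t.
Qed.

Lemma typ_in_types (K : finType) (beta : K -> R * R) x :
  generic a beta x -> typ m a beta p0 x \in types m a beta p0.
Proof. by move=> gx; rewrite inE; apply/asboolP; exists x. Qed.

Lemma images_of_opt (K : finType) (beta : K -> R * R) (e : 'I_m -> K) x y pi :
  (forall i p, hdist (beta (e i)) (a p) x = hdist (b i) (a p) y) ->
  generic a beta x -> pi \in opt y ->
  [set pi i | i : 'I_m] \in images e (typ m a beta p0 x).
Proof.
by move=> he gx py; rewrite inE; apply/asboolP; exists pi; exact: (opt_stable mn p0 he gx py).
Qed.

(* A region or an edge is recovered from the two regions met just after and
   just before it along the direction [(h, h ^ 2)]. *)
Lemma card_flat_cells : (#|[set S in cells | `[< flat S >]]| <=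
  4 ^ m.+1 * ((m * 2) ^ 2 * n ^ 2) * (4 ^ m * 4 ^ m))%N.
Proof.
have [pt ptP] := cell_points; set V := [set S in cells | _].
have VP S : S \in V -> S \in cells /\ flat (opt (pt S)).
  by rewrite in_set => /andP[SC /asboolP]; rewrite {1}(ptP _ SC).
(* A single [h] for all cells, as [beta] must not depend on [S]. *)
have [h hP] : exists h, forall S,
   [/\ forall pi, pi \in opt (curve (pt S) e1 e2 h) ->
         pi \in opt (pt S) /\ lex_below a pi e1 e2 (opt (pt S)),
       forall pi, pi \in opt (curve (pt S) me1 me2 h) ->
         pi \in opt (pt S) /\ lex_below a pi me1 me2 (opt (pt S)),
       generic a b (curve (pt S) e1 e2 h) & generic a b (curve (pt S) me1 me2 h)].
  apply: eventually_witness; apply: eventually_all => S.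
  have h1 := opt_curve a b (pt S) e1 e2; have h2 := opt_curve a b (pt S) me1 me2.
  have [|e3 h3] := @generic_curve R n m a b a_inj (pt S) e1 e2.
    by rewrite /= mulr1 mul0r subr0 oner_eq0.
  have [|e4 h4] := @generic_curve R n m a b a_inj (pt S) me1 me2.
    by rewrite /= mulrNN mulr1 mul0r subr0 oner_eq0.
  have [e [e0 he]] := eventually_and (eventually_and h1 h2)
    (eventually_and (ex_intro _ e3 h3) (ex_intro _ e4 h4)).
  by exists e; split=> // x /he[[? ?] [? ?]]; split.
(* Shifting the agents both ways instead of the translation lets the type of the one point [pt S]
   record both neighbouring regions; hence the factor [m * 2]. *)
pose beta (k : 'I_m * bool) : R * R :=
  if k.2 then ((b k.1).1 + h, (b k.1).2 + h ^+ 2)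
  else ((b k.1).1 - h, (b k.1).2 - h ^+ 2).
have betaT S i p : hdist (beta (i, true)) (a p) (pt S) =
    hdist (b i) (a p) (curve (pt S) e1 e2 h).
  by rewrite /hdist /beta /curve /sqnorm /=; ring.
have betaF S i p : hdist (beta (i, false)) (a p) (pt S) =
    hdist (b i) (a p) (curve (pt S) me1 me2 h).
  by rewrite /hdist /beta /curve /sqnorm /=; ring.
have gen S : generic a beta (pt S).
  have [_ _ g1 g2] := hP S; move=> [i []] p q pq.
    by rewrite !betaT; apply: g1.
  by rewrite !betaF; apply: g2.
have /choice[f1 f1P] S := opt_nonempty a b mn (curve (pt S) e1 e2 h).
have /choice[f2 f2P] S := opt_nonempty a b mn (curve (pt S) me1 me2 h).
pose im (f : {ffun 'I_m -> 'I_n}) := [set f i | i : 'I_m].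
pose phi S := (typ m a beta p0 (pt S), (im (f1 S), im (f2 S))).
rewrite -(@card_in_imset _ _ phi); last first.
  move=> S S' /VP[SC flS] /VP[SC' flS'] [_ im1 im2].
  have [c1 c2 _ _] := hP S; have [c1' c2' _ _] := hP S'.
  have [o1 l1] := c1 _ (f1P S); have [o2 l2] := c2 _ (f2P S).
  have [o1' l1'] := c1' _ (f1P S'); have [o2' l2'] := c2' _ (f2P S').
  have E1 := same_image_cost (f1P S) (f1P S') im1.
  have E2 := same_image_cost (f2P S) (f2P S') im2.
  have in1 : f1 S \in opt (pt S').
    by apply: opt_transfer o1' _ (E1 _); have /optP[] := o1.
  have in2 : f2 S \in opt (pt S').
    by apply: opt_transfer o2' _ (E2 _); have /optP[] := o2.
  have in1' : f1 S' \in opt (pt S).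
    by apply: opt_transfer o1 _ (esym (E1 _)); have /optP[] := o1'.
  have in2' : f2 S' \in opt (pt S).
    by apply: opt_transfer o2 _ (esym (E2 _)); have /optP[] := o2'.
  rewrite (ptP _ SC) (ptP _ SC'); apply/eqP; rewrite eqEsubset.
  by rewrite (flat_subset flS o1 o2) // (flat_subset flS' o1' o2').
pose B tau := setX (images (fun i => (i, true)) tau) (images (fun i => (i, false)) tau).
pose TT := [set z | (z.1 \in types m a beta p0) && (z.2 \in B z.1)].
apply: (@leq_trans #|TT|).
  apply: subset_leq_card; apply/subsetP => _ /imsetP[S _ ->].
  rewrite inE /phi typ_in_types //= in_setX.
  by rewrite !(images_of_opt _ (gen S) (f1P S), images_of_opt _ (gen S) (f2P S)).
apply: (@leq_trans (#|types m a beta p0| * (4 ^ m * 4 ^ m))).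
  apply: card_fibers => tau tT; rewrite cardsX.
  by apply: leq_mul; apply: card_images tT.
rewrite leq_mul2r; apply/orP; right.
have := @card_types R n m _ a beta p0 (k0, true) mn.
by rewrite card_prod card_bool card_ord.
Qed.

(** Take [sigma] with gradient off the line through the two extreme ones, and move from [t]
    perpendicularly to that line, with the sign [sg] favouring the side of [sigma]. A matching [pi3]
    optimal there has its gradient at least as far on that side. *)
Lemma vertex_witness t : ~ flat (opt t) -> exists z : (R * R) * {ffun 'I_m -> 'I_n} * bool,
  [/\ generic a b z.1.1, z.1.2 \in opt z.1.1 & exists pi1 pi2,
    [/\ [/\ pi1 \in opt t, pi2 \in opt t & z.1.2 \in opt t],
     lex_below a pi1 e1 e2 (opt t), lex_below a pi2 me1 me2 (opt t) &
     0 < (-1) ^+ z.2 * cross (gradB a pi2 pi1) (gradB a z.1.2 pi1)]].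
Proof.
move=> nf; have [pi1 [pi2 [sigma [[o1 o2 os] l1 l2 c0]]]] : exists pi1 pi2 sigma,
    [/\ [/\ pi1 \in opt t, pi2 \in opt t & sigma \in opt t],
     lex_below a pi1 e1 e2 (opt t), lex_below a pi2 me1 me2 (opt t) &
     cross (gradB a pi2 pi1) (gradB a sigma pi1) != 0].
  apply: contrapT => h; apply: nf => pi1 pi2 sigma o1 o2 os l1 l2.
  by apply/eqP/negPn/negP => c0; apply: h; exists pi1, pi2, sigma.
set d := gradB a pi2 pi1 in c0 *; set c := cross _ _ in c0.
pose s : bool := c < 0; pose sg : R := (-1) ^+ s.
have sgc : 0 < sg * c.
  rewrite /sg /s; case: (ltrgtP c 0) c0 => // c1 _; first by rewrite /= expr1 mulN1r oppr_gt0.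
  by rewrite /= expr0 mul1r.
have d0 : d.1 ^+ 2 + d.2 ^+ 2 != 0.
  apply: contra_neq c0 => dz; rewrite /c /cross.
  have : d.1 ^+ 2 == 0 /\ d.2 ^+ 2 == 0.
    by apply/andP; rewrite -paddr_eq0 ?sqr_ge0 // dz.
  by rewrite !sqrf_eq0 => -[/eqP -> /eqP ->]; rewrite !mul0r subrr.
(* The second-order direction [d] is orthogonal to the first, which makes the curve generic. *)
have [|eg hg] := @generic_curve R n m a b a_inj t (sg * d.2, - (sg * d.1)) d.
  rewrite /=; have -> : sg * d.2 * d.2 - - (sg * d.1) * d.1 = sg * (d.1 ^+ 2 + d.2 ^+ 2) by ring.
  by rewrite mulf_neq0 // signr_eq0.
have [h [cu gx]] := eventually_witness (eventually_and
  (opt_curve a b t (sg * d.2, - (sg * d.1)) d) (ex_intro _ eg hg)).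
have [pi3 o3] := opt_nonempty a b mn (curve t (sg * d.2, - (sg * d.1)) d h).
have [o3t l3] := cu _ o3.
exists (curve t (sg * d.2, - (sg * d.1)) d h, pi3, s); split=> //=.
exists pi1, pi2; split=> //; apply: lt_le_trans sgc _.
rewrite -/d -/sg /c /cross [gradB a pi3 _]/gradB [gradB a sigma _]/gradB.
have : dotp (grad a pi3) (sg * d.2, - (sg * d.1)) <= dotp (grad a sigma) (sg * d.2, - (sg * d.1)).
  by case: (l3 _ os) => [/ltW//|[-> _]].
rewrite /dotp; clearbody d sg; move: (grad a pi1) (grad a pi3) (grad a sigma) => [? ?] [? ?] [? ?] /=; lra.
Qed.

Lemma card_vertices : (#|[set S in cells | ~~ `[< flat S >]]| <=
  4 ^ m.+1 * (m ^ 2 * n ^ 2) * (4 ^ m * 2))%N.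
Proof.
have [pt ptP] := cell_points; set V := [set S in cells | _].
have VP S : S \in V -> S \in cells /\ ~ flat (opt (pt S)).
  by rewrite in_set => /andP[SC /asboolP]; rewrite {1}(ptP _ SC).
have [|wit witP] := @choice _ _ (fun S (z : (R * R) * {ffun 'I_m -> 'I_n} * bool) =>
  S \in V -> [/\ generic a b z.1.1, z.1.2 \in opt z.1.1 & exists pi1 pi2,
    [/\ [/\ pi1 \in opt (pt S), pi2 \in opt (pt S) & z.1.2 \in opt (pt S)],
     lex_below a pi1 e1 e2 (opt (pt S)), lex_below a pi2 me1 me2 (opt (pt S)) &
     0 < (-1) ^+ z.2 * cross (gradB a pi2 pi1) (gradB a z.1.2 pi1)]]).
  move=> S; have [/VP[_ /vertex_witness[z hz]]|_] := boolP (S \in V); first by exists z.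
  by exists ((0, 0), [ffun=> p0], true).
pose im (f : {ffun 'I_m -> 'I_n}) := [set f i | i : 'I_m].
(* The type is taken at the nearby point itself, so here the agents are not doubled. *)
pose phi S := (typ m a b p0 (wit S).1.1, (im (wit S).1.2, (wit S).2)).
rewrite -(@card_in_imset _ _ phi); last first.
  move=> S S' SV SV' [_ imE sE].
  have [SC _] := VP _ SV; have [SC' _] := VP _ SV'.
  have [_ q3 [pi1 [pi2 [[o1 o2 o3] l1 l2 c]]]] := witP _ SV.
  have [_ q3' [pi1' [pi2' [[o1' o2' o3'] l1' l2' c']]]] := witP _ SV'.
  have E := same_image_cost q3 q3' imE.
  rewrite (ptP _ SC) (ptP _ SC'); congr (opt _); rewrite sE in c.
  exact: vertex_unique o1 o2 o3 o1' o2' o3' l1 l2 l1' l2' c c' E.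
pose B tau := setX (images id tau) [set: bool].
pose TT := [set z | (z.1 \in types m a b p0) && (z.2 \in B z.1)].
apply: (@leq_trans #|TT|).
  apply: subset_leq_card; apply/subsetP => _ /imsetP[S SV ->].
  have [gx q3 _] := witP _ SV.
  rewrite inE /phi typ_in_types //= in_setX in_setT andbT.
  by apply: images_of_opt gx q3.
apply: (@leq_trans (#|types m a b p0| * (4 ^ m * 2))).
  apply: card_fibers => tau tT; rewrite cardsX cardsT card_bool.
  by rewrite leq_mul2r (card_images _ tT) orbT.
rewrite leq_mul2r; apply/orP; right.
by have := @card_types R n m _ a b p0 k0 mn; rewrite card_ord.
Qed.

End Complexity.

(** The two counts are [16 * n ^ 2 * m ^ 2 * 64 ^ m] and [8 * n ^ 2 * m ^ 2 * 16 ^ m]. *)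
Lemma pm_complexity_le (R : realType) (n m : nat) (a : 'I_n -> R * R) (b : 'I_m -> R * R) :
  injective a -> (0 < m <= n)%N ->
  (pm_complexity a b <= 24 * (n ^ 2 * m ^ 2 * 64 ^ m))%N.
Proof.
move=> a_inj mn; have [m0 le_mn] := andP mn.
have n0 : (0 < n)%N by apply: leq_trans le_mn.
rewrite -[pm_complexity a b]/#|cells a b|.
rewrite -(cardsID [set S | `[< flat a S >]] (cells a b)).
have h1 := card_flat_cells b a_inj mn (Ordinal n0) (Ordinal m0).
have h2 := card_vertices b a_inj mn (Ordinal n0) (Ordinal m0).
apply: leq_trans (leq_add (_ : _ <= 4 ^ m.+1 * ((m * 2) ^ 2 * n ^ 2) * (4 ^ m * 4 ^ m))%N
  (_ : _ <= 4 ^ m.+1 * (m ^ 2 * n ^ 2) * (4 ^ m * 2))%N) _.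
- apply: leq_trans h1; apply: subset_leq_card; apply/subsetP => S.
  by rewrite in_setI !in_set.
- apply: leq_trans h2; apply: subset_leq_card; apply/subsetP => S.
  by rewrite in_setD !in_set andbC.
have -> : (64 ^ m = 4 ^ m * 4 ^ m * 4 ^ m)%N by rewrite -!expnMn.
rewrite expnS expnMn; have : (0 < 4 ^ m)%N by rewrite expn_gt0.
move: (4 ^ m)%N (m ^ 2)%N (n ^ 2)%N => u v w u0.
have : (u * u * (v * w) <= u * u * u * (v * w))%N.
  by rewrite leq_mul2r -[X in (X <= _)%N]muln1 leq_mul ?orbT.
nia.
Qed.

(** * Passage to the logarithmic bound *)

Lemma exponential_vs_log (R : realType) (c : R) : 1 <= c ->
  exists C : R, 0 < C /\ forall m : nat, (0 < m)%N ->
    c ^+ m <= C * (expR 1 * ln (m%:R) + expR 1) ^+ m.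
Proof.
(* Beyond [M] one has [c <= ln m], so the base on the right exceeds [c]; the factor [c ^+ M] absorbs
   the smaller [m]. *)
move=> c1; pose M := (Num.bound (expR c)).
have c0 : 0 < c by apply: lt_le_trans c1.
exists (c ^+ M); split=> [|m m0]; first by rewrite exprn_gt0.
have m1 : (1 : R) <= m%:R by rewrite ler1n.
have l0 : 0 <= ln (m%:R : R) by apply: ln_ge0.
have e1 : (1 : R) <= expR 1 by have := expR_ge1Dx (1 : R); lra.
have cM : 1 <= c ^+ M by rewrite exprn_ege1.
have base : 1 <= expR 1 * ln (m%:R : R) + expR 1.
  by have := mulr_ge0 (expR_ge0 (1 : R)) l0; lra.
have [mM|Mm] := leqP m M.
  apply: (@le_trans _ _ (c ^+ M)); first by rewrite ler_weXn2l.
  by rewrite ler_peMr ?exprn_ege1 // exprn_ge0 // ltW.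
have cb : c <= expR 1 * ln (m%:R : R) + expR 1.
  have : expR c <= m%:R.
    apply: (le_trans (ltW (archi_boundP (expR_ge0 c)))).
    by rewrite ler_nat ltnW.
  move=> h; have : c <= ln (m%:R : R).
    by rewrite -[c]expRK ler_ln // posrE ?expR_gt0 ?ltr0n.
  have := mulr_ge0 (_ : 0 <= expR 1 - 1) l0; rewrite subr_ge0 => /(_ e1); lra.
apply: (@le_trans _ _ ((expR 1 * ln (m%:R : R) + expR 1) ^+ m)).
  by rewrite lerXn2r // nnegrE ltW // (lt_le_trans ltr01).
by rewrite ler_peMl // exprn_ge0 // (le_trans ler01).
Qed.

Theorem theorem2 (R : realType) :
  exists C : R, 0 < C /\
    forall (n m : nat) (a : 'I_n -> R * R) (b : 'I_m -> R * R),
      injective a -> injective b -> (1 <= m <= n)%N ->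
      (pm_complexity a b)%:R
        <= C * n%:R ^+ 2 * (m%:R ^+ 3 * Num.sqrt (m%:R))
             * (expR 1 * ln (m%:R) + expR 1) ^+ m.
Proof.
have [|C [C0 hC]] := @exponential_vs_log R 64; first by rewrite (ler_nat R 1).
exists (24 * C); split=> [|n m a b a_inj _ mn]; first by rewrite mulr_gt0.
have [m0 _] := andP mn.
apply: (@le_trans _ _ ((24 * (n ^ 2 * m ^ 2 * 64 ^ m))%N%:R)).
  by rewrite ler_nat pm_complexity_le.
rewrite 3!natrM 3!natrX; set E := (_ + _) ^+ m.
have m1 : (1 : R) <= m%:R by rewrite ler1n.
(* The factor [m ^ 2] obtained lies within the allowed [m ^ 3.5]. *)
have poly : (m%:R : R) ^+ 2 <= m%:R ^+ 3 * Num.sqrt m%:R.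
  apply: (@le_trans _ _ (m%:R ^+ 3)); first by rewrite ler_weXn2l.
  rewrite ler_peMr ?exprn_ge0 // -[X in X <= _]sqrtr1.
  by rewrite ler_sqrt // (lt_le_trans ltr01).
have n2 : 0 <= (n%:R : R) ^+ 2 by rewrite exprn_ge0.
have -> : 24 * C * n%:R ^+ 2 * (m%:R ^+ 3 * Num.sqrt m%:R) * E =
  24 * ((n%:R ^+ 2 * (m%:R ^+ 3 * Num.sqrt m%:R)) * (C * E)) by ring.
rewrite ler_wpM2l //; apply: ler_pM.
- by rewrite mulr_ge0 // exprn_ge0.
- by rewrite exprn_ge0.
- by rewrite ler_wpM2l.
- exact: hC.
Qed.
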